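(* Let $n$ be a positive integer, let $V_{8n} = \langle a, b \mid a^{2n} = b^{4} = 1,\ ba = a^{-1}b^{-1},\ b^{-1}a = a^{-1}b \rangle$, let $\mathbb{F}$ be an algebraic extension of a prime field, and let $p$ be an odd rational prime. (i) If $\mathrm{char}(\mathbb{F})$ is either $0$ or $p$ with $\gcd(n,p)=1$, then all derivations of $\mathbb{F}V_{8n}$ are inner, that is, $\mathrm{Der}(\mathbb{F}V_{8n}) = \mathrm{Der}_{\mathrm{inn}}(\mathbb{F}V_{8n})$. In other words, $\mathbb{F}V_{8n}$ has no non-zero outer derivations. (ii) If $\mathrm{char}(\mathbb{F}) = p$ with $\gcd(n,p) \neq 1$, then $\mathrm{Der}_{\mathrm{inn}}(\mathbb{F}V_{8n}) \subsetneq \mathrm{Der}(\mathbb{F}V_{8n})$. In other words, $\mathbb{F}V_{8n}$ has non-zero outer derivations.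
   Context: $V_{8n}$ is a group of order $8n$ and $\mathbb{F}V_{8n}$ is its group algebra over $\mathbb{F}$. A derivation of a ring $R$ is an additive map $d: R \to R$ with $d(xy) = d(x)y + x\,d(y)$ for all $x,y \in R$ (no linearity over a base field is required). It is inner if there is $\beta \in R$ with $d(\alpha) = \alpha\beta - \beta\alpha$ for all $\alpha \in R$, and outer if it is not inner. $\mathrm{Der}(R)$ and $\mathrm{Der}_{\mathrm{inn}}(R)$ denote the sets of all derivations and of all inner derivations of $R$. *)

(* Defs.v *)
From HB Require Import structures.
From mathcomp Require Import all_boot all_order all_fingroup all_algebra.
From mathcomp Require Import classical_sets.

Set Implicit Arguments.
Unset Strict Implicit.
Unset Printing Implicit Defensive.

Import GRing.Theory.

Local Open Scope ring_scope.

(* An element f stands for the formal sum \sum_x f x * x. The alias is needed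
   because {ffun gT -> F} already carries the pointwise product. *)
Definition group_algebra (F : fieldType) (gT : finGroupType) : Type :=
  {ffun gT -> F}.

Section GroupAlgebra.
Variables (F : fieldType) (gT : finGroupType).

Local Notation FG := (group_algebra F gT).

HB.instance Definition _ := GRing.Zmodule.copy FG {ffun gT -> F}.

Definition galg_of (x : gT) : FG := [ffun y => (y == x)%:R].

Definition galg_one : FG := galg_of 1%g.

Definition galg_mul (f g : FG) : FG :=
  [ffun x => \sum_(y : gT) f y * g (y^-1 * x)%g].

Fact galg_mulA : associative galg_mul.
Proof.
move=> f g h; apply/ffunP=> x; rewrite !ffunE.
under eq_bigr => y _ do rewrite ffunE mulr_sumr.
under [RHS]eq_bigr => z _ do rewrite ffunE mulr_suml.
rewrite [RHS]exchange_big /=; apply: eq_bigr => y _.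
rewrite (reindex_inj (mulgI y^-1%g)) /=; apply: eq_bigr => z _.
by rewrite mulrA invMg invgK -mulgA (mulgA y) mulgV mul1g.
Qed.

Fact galg_mul1l : left_id galg_one galg_mul.
Proof.
move=> f; apply/ffunP=> x; rewrite ffunE (bigD1 1%g) //= ffunE eqxx mul1r.
rewrite invg1 mul1g big1 ?addr0 // => y /negPf ny1.
by rewrite ffunE ny1 mul0r.
Qed.

Fact galg_mul1r : right_id galg_one galg_mul.
Proof.
move=> f; apply/ffunP=> x; rewrite ffunE (bigD1 x) //= ffunE mulVg eqxx mulr1.
rewrite big1 ?addr0 // => y nyx; rewrite ffunE -eq_mulVg1.
by rewrite (negPf nyx) mulr0.
Qed.

Fact galg_mulDl : left_distributive galg_mul +%R.
Proof.
move=> f g h; apply/ffunP=> x; rewrite !ffunE -big_split /=.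
by apply: eq_bigr => y _; rewrite ffunE mulrDl.
Qed.

Fact galg_mulDr : right_distributive galg_mul +%R.
Proof.
move=> f g h; apply/ffunP=> x; rewrite !ffunE -big_split /=.
by apply: eq_bigr => y _; rewrite ffunE mulrDr.
Qed.

Fact galg_one_neq0 : galg_one != 0.
Proof.
apply/eqP=> /ffunP/(_ 1%g); rewrite !ffunE eqxx.
by apply/eqP; rewrite oner_eq0.
Qed.

HB.instance Definition _ := GRing.Zmodule_isNzRing.Build FG
  galg_mulA galg_mul1l galg_mul1r galg_mulDl galg_mulDr galg_one_neq0.

HB.instance Definition _ := GRing.Lmodule.copy FG {ffun gT -> F^o}.

Fact galg_scaleAl (k : F) (f g : FG) : k *: (f * g) = (k *: f) * g.
Proof.
apply/ffunP=> x; rewrite !ffunE scaler_sumr.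
by apply: eq_bigr => y _; rewrite ffunE /= scalerAl.
Qed.

HB.instance Definition _ := GRing.Lmodule_isLalgebra.Build F FG galg_scaleAl.

Fact galg_scaleAr (k : F) (f g : FG) : k *: (f * g) = f * (k *: g).
Proof.
apply/ffunP=> x; rewrite !ffunE scaler_sumr.
by apply: eq_bigr => y _; rewrite ffunE /= scalerAr.
Qed.

HB.instance Definition _ := GRing.Lalgebra_isAlgebra.Build F FG galg_scaleAr.

End GroupAlgebra.

Section Derivations.
Variable R : nzRingType.

Definition is_derivation (d : R -> R) : Prop :=
  (forall x y, d (x + y) = d x + d y) /\
  (forall x y, d (x * y) = d x * y + x * d y).

Definition is_inner (d : R -> R) : Prop :=
  exists beta, forall alpha, d alpha = alpha * beta - beta * alpha.

Definition Der : set (R -> R) := [set d | is_derivation d]%classic.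

(* A map of the form alpha * beta - beta * alpha is always a derivation; the
   conjunct is kept to follow the definition of an inner derivation. *)
Definition Der_inn : set (R -> R) :=
  [set d | is_derivation d /\ is_inner d]%classic.

Definition outer_derivation (d : R -> R) : Prop :=
  is_derivation d /\ ~ is_inner d.

End Derivations.

Arguments Der R : clear implicits.
Arguments Der_inn R : clear implicits.

(* Prime fields are, up to isomorphism, rat and the 'F_q with q prime; the
   embedding into F is unique when it exists. *)
Definition algebraic_over (K F : fieldType) : Prop :=
  exists iota : {rmorphism K -> F}, forall x : F, algebraicOver iota x.

Definition algebraic_over_prime_field (F : fieldType) : Prop :=
  algebraic_over rat F \/ exists2 q : nat, prime q & algebraic_over 'F_q F.

(* [\isog Grp] characterizes the largest finite quotient of the presented
   group; the group presented here is finite (of order 8n) when n > 0, so gT is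
   the presented group itself. *)
Definition is_V8n (n : nat) (gT : finGroupType) : Prop :=
  ([set: gT] \isog Grp (a : b : a ^+ (2 * n) = b ^+ 4 = 1,
                        b * a = a^-1 * b^-1,
                        b^-1 * a = a^-1 * b))%g.

(* Main.v *)
Require Import Defs.
From HB Require Import structures.
From mathcomp Require Import boolp classical_sets.
From mathcomp Require Import all_boot all_order all_fingroup all_algebra.
From mathcomp Require Import cyclic.
From mathcomp Require finfield.

Set Implicit Arguments.
Unset Strict Implicit.
Unset Printing Implicit Defensive.

Import GRing.Theory.

Local Open Scope ring_scope.

(* Part (i): the coordinates of d (k 1), for k in F, are derivations of F, and a
   derivation of an algebraic extension of a prime field vanishes, so d is
   F-linear. As |G| divides 16 n, it is invertible in F and averaging gives
   d = [., beta] with beta = - |G|^-1 sum_h d(h) h^-1.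
   Part (ii): when p divides n, a |-> (x |-> x + 1), b |-> (x |-> - x) is an
   action of G on 'F_p, say g |-> (x |-> eps(g) x + psi(g)). The element
   w = a^2 - a^-2 satisfies g w = eps(g) w g, so that g |-> psi(g) g w extends
   to a derivation. It maps a to a^3 - a^-1, whose coefficients over the conjugacy
   class of a^-1 do not sum to 0; they would if the derivation were inner. *)

(** * Derivations of algebraic extensions of prime fields *)

Section FieldDerivations.
Variables (F : fieldType) (D : F -> F).
Hypothesis D_der : is_derivation D.

Lemma derivation0 : D 0 = 0.
Proof. by apply: (addrI (D 0)); rewrite -D_der.1 !addr0. Qed.

Lemma derivation1 : D 1 = 0.
Proof. by apply: (addrI (D 1)); rewrite addr0 -{3}(mulr1 1) D_der.2 mulr1 mul1r. Qed.

Lemma derivation_nat m : D m%:R = 0.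
Proof.
elim: m => [|m IHm]; first exact: derivation0.
by rewrite -natr1 D_der.1 IHm derivation1 addr0.
Qed.

Lemma derivation_opp x : D (- x) = - D x.
Proof. by apply/eqP; rewrite -addr_eq0 -D_der.1 addNr derivation0. Qed.

Lemma derivation_rat (iota : {rmorphism rat -> F}) x : D (iota x) = 0.
Proof.
have Dint (z : int) : D z%:~R = 0.
  by case: z => m; rewrite ?NegzE ?rmorphN ?derivation_opp /= derivation_nat ?oppr0.
have denx0 : (denq x)%:~R != 0 :> rat by rewrite intr_eq0 denq_neq0.
have def_num : iota x * (denq x)%:~R = (numq x)%:~R.
  by rewrite -!(rmorph_int iota) -rmorphM /= -{1}(divq_num_den x) divfK.
have iden0 : (denq x)%:~R != 0 :> F by rewrite -(rmorph_int iota) fmorph_eq0.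
have := D_der.2 (iota x) (denq x)%:~R; rewrite def_num !Dint mulr0 addr0.
by move/esym/eqP; rewrite mulf_eq0 (negPf iden0) orbF => /eqP.
Qed.

Lemma derivation_Fp q (iota : {rmorphism 'F_q -> F}) x : D (iota x) = 0.
Proof. by rewrite -(natr_Zp x) rmorph_nat derivation_nat. Qed.

Lemma derivation_horner (K : fieldType) (iota : {rmorphism K -> F})
    (P : {poly K}) x :
  (forall a, D (iota a) = 0) ->
  D (map_poly iota P).[x] = (map_poly iota P^`()).[x] * D x.
Proof.
move=> Diota; elim/poly_ind: P => [|P c IHP].
  by rewrite derivC rmorph0 horner0 derivation0 mul0r.
rewrite derivD derivM derivX derivC mulr1 addr0.
rewrite !rmorphD !rmorphM /= map_polyX map_polyC /= !hornerE.
by rewrite D_der.1 Diota addr0 D_der.2 IHP mulrDl addrC mulrAC addrC.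
Qed.

(** Descent on the size of an annihilating polynomial [P]. If P'(x) is nonzero, the chain rule gives
    D x = 0; if P'(x) = 0 with P' nonzero, P' replaces [P]. The case P' = 0 depends on the
    characteristic and is left as a hypothesis. *)
Lemma derivation_root (K : fieldType) (iota : {rmorphism K -> F}) x :
  (forall a, D (iota a) = 0) ->
  (forall P : {poly K}, P != 0 -> P^`() = 0 -> root (map_poly iota P) x ->
     exists2 Q : {poly K}, (size Q < size P)%N
       & Q != 0 /\ root (map_poly iota Q) x) ->
  algebraicOver iota x -> D x = 0.
Proof.
move=> Diota descent [P nzP rootP].
elim/ltn_ind: {P}(size P) {-2}P (erefl (size P)) nzP rootP => m IHm P szP nzP Px0.
have [P'0 | nzP'] := eqVneq P^`() 0.
  by have [Q ltQP [nzQ Qx0]] := descent P nzP P'0 Px0;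
    apply: (IHm (size Q)) Qx0; rewrite // -szP.
have [P'x0 | nzP'x] := boolP (root (map_poly iota P^`()) x).
  by apply: (IHm (size P^`())) P'x0; rewrite // -szP lt_size_deriv.
have := derivation_horner P x Diota; rewrite (rootP Px0) derivation0.
by move/esym/eqP; rewrite mulf_eq0 -rootE (negPf nzP'x) => /eqP.
Qed.

End FieldDerivations.

(** Over [rat], P' = 0 makes [P] constant, hence without roots unless zero. Over ['F_q] it makes P =
    Q(X^q); as Frobenius fixes ['F_q], P(x) = Q(x)^q, so [x] is a root of [Q]. *)
Lemma derivation_algebraic_over_prime_field (F : fieldType) (D : F -> F) :
  algebraic_over_prime_field F -> is_derivation D -> forall x, D x = 0.
Proof.
move=> F_alg D_der x; case: F_alg => [[iota algF] | [q q_pr [iota algF]]].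
  apply: (derivation_root D_der (derivation_rat D_der iota) _ (algF x)).
  move=> P nzP P'0; suff /size1_polyC defP: (size P <= 1)%N.
    rewrite defP map_polyC rootC fmorph_eq0 => /eqP P00.
    by rewrite defP P00 eqxx in nzP.
  rewrite leqNgt; apply: contraT; rewrite negbK => szP.
  (* This coefficient is deg P times the leading coefficient, hence nonzero in characteristic 0. *)
  have := congr1 (fun p : {poly rat} => p`_(size P).-2) P'0.
  rewrite coef_deriv coef0 prednK -?subn1 ?subn_gt0 // => /eqP.
  rewrite subn1 Num.Theory.mulrn_eq0 -lead_coefE lead_coef_eq0 (negPf nzP) orbF.
  by case: (size P) szP => [|[]].
apply: (derivation_root D_der (derivation_Fp D_der iota) _ (algF x)).
move=> P nzP P'0 Px0.
have q_gt0 := prime_gt0 q_pr; have qF := pchar_Fp q_pr.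
have qF' : q \in [pchar F] by rewrite (fmorph_pchar iota).
have Pcoef i : ~~ (q %| i)%N -> P`_i = 0.
  case: i => [|i]; first by rewrite dvdn0.
  move=> qi; have := congr1 (fun p : {poly 'F_q} => p`_i) P'0.
  rewrite coef_deriv coef0 -mulr_natr => /eqP.
  by rewrite mulf_eq0 -(dvdn_pcharf qF) (negPf qi) orbF => /eqP.
pose Q : {poly 'F_q} := \poly_(j < size P) P`_(q * j).
have defP : P = Q \Po 'X^q.
  apply/polyP=> i; rewrite coef_comp_poly_Xn //; case: ifP => [qi | /negbT/Pcoef //].
  rewrite coef_poly mulnC divnK //; case: ltnP => // szPi.
  by rewrite nth_default // (leq_trans szPi) ?leq_div.
have nzQ : Q != 0 by apply: contraNneq nzP; rewrite {1}defP => ->; rewrite comp_poly0.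
have frobQ : (map_poly iota Q).[x ^+ q] = (map_poly iota Q).[x] ^+ q.
  elim/poly_ind: Q {defP nzQ} => [|Q c IHQ].
    by rewrite rmorph0 !horner0 expr0n gtn_eqF.
  rewrite rmorphD rmorphM /= map_polyX map_polyC /= !hornerE IHQ.
  rewrite -!(pFrobenius_autE qF') rmorphD rmorphM /= !pFrobenius_autE.
  by rewrite -rmorphXn /=; have := finfield.expf_card c; rewrite card_Fp // => ->.
exists Q; last first.
  split=> //; move: Px0; rewrite {1}defP map_comp_poly map_polyXn !rootE.
  rewrite horner_comp hornerXn.
  by rewrite frobQ expf_eq0 q_gt0.
have: (size P).-1 = ((size Q).-1 * q)%N by rewrite {1}defP size_comp_poly size_polyXn.
(* [P] is nonzero and has a root, so deg P = q deg Q is positive and deg Q < deg P. *)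
have szP : (1 < size P)%N.
  rewrite ltnNge; apply: contra nzP => /size1_polyC defP0.
  by move: Px0; rewrite defP0 map_polyC rootC fmorph_eq0 polyC_eq0.
have := prime_gt1 q_pr; have := size_poly_gt0 Q; rewrite nzQ.
case: (size P) szP => [|[|m]] // _; case: (size Q) => // k _ q1 /= mkq.
by rewrite ltnS mkq; case: k mkq => // k _; rewrite ltn_Pmulr.
Qed.

(** * The group V_8n: universal property and order *)

Definition V8n_relations n (rT : finGroupType) (r s : rT) : Prop :=
  [/\ r ^+ (2 * n) = 1, s ^+ 4 = 1, s * r = r^-1 * s^-1
    & s^-1 * r = r^-1 * s]%g.

Section GroupV8n.
Variables (n : nat) (gT : finGroupType).
Hypothesis V8n : is_V8n n gT.

Lemma V8n_generators :
  exists a b : gT, V8n_relations n a b /\ <<[set a; b]>>%g = [set: gT].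
Proof.
have /existsP[[a b] /= /eqP[defG a1 b1 ba b'a]] := isoGrp_hom V8n.
exists a, b; split; first by split.
apply/eqP; rewrite eqEsubset subsetT -defG join_subG.
by rewrite !cycle_subG !mem_gen ?inE ?eqxx ?orbT.
Qed.

(** The universal property encoded in [is_V8n]: being a homomorphic image of [gT] amounts to being
    generated by a pair that satisfies the relations. *)
Lemma V8n_homg (rT : finGroupType) (r s : rT) :
  V8n_relations n r s -> (<[r]> <*> <[s]> \homg [set: gT])%g.
Proof.
move=> [r1 s1 sr s'r]; rewrite V8n; apply/existsP; exists (r, s) => /=.
by rewrite /= r1 s1 sr s'r !xpair_eqE !eqxx.
Qed.

(* The subgroup of gT * rT generated by (a, r) and (b, s) is a homomorphic image
   of gT which projects onto gT, so by cardinality it is a graph. *)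
Lemma V8n_morphism (rT : finGroupType) (a b : gT) (r s : rT) :
  V8n_relations n a b -> <<[set a; b]>>%g = [set: gT] -> V8n_relations n r s ->
  exists f : gT -> rT, [/\ {morph f : x y / x * y}%g, f a = r & f b = s].
Proof.
move=> [a1 b1 ba b'a] genG [r1 s1 sr s'r].
pose K := (<[(a, r)]> <*> <[(b, s)]>)%G.
have expg_pair (u : gT) (v : rT) m : ((u, v) ^+ m = (u ^+ m, v ^+ m))%g.
  by elim: m => // m IHm; rewrite !expgS IHm.
have homK : (K \homg [set: gT])%g.
  apply: V8n_homg; split; rewrite ?expg_pair ?a1 ?b1 ?r1 ?s1 //.
    by congr (_, _).
  by congr (_, _).
have Ka : (a, r) \in K by rewrite (subsetP (joing_subl _ _)) ?cycle_id.
have Kb : (b, s) \in K by rewrite (subsetP (joing_subr _ _)) ?cycle_id.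
have fstK : [set k.1 | k in K] = [set: gT].
  have fstE : [set k.1 | k in K] = (fst_morphism gT rT @* K)%g.
    by rewrite morphimEsub ?subsetT.
  apply/eqP; rewrite eqEsubset subsetT -genG fstE gen_subG subUset !sub1set /=.
  apply/andP; split.
    exact: (mem_morphim (fst_morphism gT rT) (in_setT (a, r)) Ka).
  exact: (mem_morphim (fst_morphism gT rT) (in_setT (b, s)) Kb).
have injK : {in K &, injective (@fst gT rT)}.
  by apply/imset_injP; rewrite eqn_leq leq_imset_card fstK leq_homg.
have Kex (g : gT) : exists k, (k \in K) && (k.1 == g).
  have : g \in [set k.1 | k in K] by rewrite fstK inE.
  by case/imsetP=> k Kk ->; exists k; rewrite Kk eqxx.
pose f g := (xchoose (Kex g)).2.
have Kf g : (g, f g) \in K.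
  by rewrite /f; have /andP[] := xchooseP (Kex g); case: (xchoose _) => ? ? ? /eqP /= <-.
have fE g u : (g, u) \in K -> f g = u.
  by move=> Kgu; have [] := injK _ _ (Kf g) Kgu erefl.
exists f; split; [move=> x y | exact: fE | exact: fE].
by apply: fE; apply: (groupM (Kf x) (Kf y)).
Qed.

(* The bound comes from G = <a, b^2> <b>, where b^2 is central and b
   normalises <a, b^2>. *)
Lemma V8n_card_dvd : (#|gT| %| 16 * n)%N.
Proof.
have [a [b [[a1 b1 ba b'a] genG]]] := V8n_generators.
have babE : (b * a * b = a^-1)%g by rewrite ba mulgKV.
have b'ab'E : (b^-1 * a * b^-1 = a^-1)%g by rewrite b'a mulgK.
(* Both b a b and b^-1 a b^-1 equal a^-1, so b^2 a b^2 = a, and b^2 is its own inverse. *)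
have b2C : commute a (b ^+ 2)%g.
  have b2V : (b ^+ 2)^-1%g = (b ^+ 2)%g by apply/eqP; rewrite eq_invg_mul -expgD b1.
  apply: (mulIg (b ^+ 2)%g); rewrite -{2}b2V mulgK -mulgA.
  apply: (mulgI b^-1%g); apply: (mulIg b^-1%g).
  by rewrite b'ab'E expgS expg1 !mulgA mulVg mul1g mulgK babE.
have dvd_mulg (A B : {group gT}) : (#|A * B|%g %| #|A| * #|B|)%N.
  by rewrite mul_cardG dvdn_mulr.
have NE : (<[a]> <*> <[b ^+ 2]> = <[a]> * <[b ^+ 2]>)%g.
  by apply: cent_joinEr; apply/cents_cycle/commute_sym.
have bN : (<[b]> \subset 'N(<[a]> <*> <[b ^+ 2]>))%g.
  rewrite cycle_subG inE conjYg join_subG -!cycleJ !cycle_subG /=.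
  have b2bb : ((b ^+ 2) ^ b = b ^+ 2)%g by rewrite conjXg conjgE mulKg.
  have ab : (a ^ b = a^-1 * b ^+ 2)%g by rewrite conjgE mulgA b'a -mulgA.
  rewrite b2bb ab NE mem_mulg ?groupV ?cycle_id //.
  by rewrite -[X in X \in _]mul1g mem_mulg ?cycle_id.
have -> : #|gT| = #|(<[a]> <*> <[b ^+ 2]> <*> <[b]>)%g|.
  apply: eq_card => x; rewrite !inE; apply/esym.
  have : x \in [set: gT] by rewrite inE.
  rewrite -genG; apply/subsetP; rewrite gen_subG subUset !sub1set.
  apply/andP; split; last by rewrite (subsetP (joing_subr _ _)) ?cycle_id.
  by rewrite (subsetP (joing_subl _ _)) // (subsetP (joing_subl _ _)) ?cycle_id.
rewrite norm_joinEr //; apply: dvdn_trans (dvd_mulg _ _) _.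
(* The orders of [a], [b ^+ 2] and [b] divide 2n, 2 and 4. The excess factor 2 over 8n is harmless,
   since the bound serves only where 2 is invertible. *)
have -> : (16 * n = (2 * n * 2) * 4)%N by rewrite -!mulnA mulnCA mulnC.
apply: dvdn_mul; last by rewrite order_dvdn b1.
rewrite /= NE; apply: dvdn_trans (dvd_mulg _ _) _.
by apply: dvdn_mul; rewrite order_dvdn ?a1 // -expgM b1.
Qed.

End GroupV8n.

(** * Inner and twisted derivations of a group algebra *)

Section GroupAlgebraDerivations.
Variables (F : fieldType) (gT : finGroupType).
Local Notation FG := (group_algebra F gT).
Local Notation of_ := (@galg_of F gT).

Lemma galg_ofM (x y : gT) : of_ (x * y)%g = of_ x * of_ y.
Proof.
apply/ffunP=> z; rewrite !ffunE (bigD1 x) //= !ffunE eqxx mul1r big1 => [|u nux].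
  rewrite addr0; suff -> : (z == x * y)%g = (x^-1 * z == y)%g by [].
  by apply/eqP/eqP => [->|<-]; rewrite ?mulKg ?mulKVg.
by rewrite ffunE (negPf nux) mul0r.
Qed.

Lemma galg_of1 : of_ 1%g = 1.
Proof. by []. Qed.

Lemma galg_sum (f : FG) : f = \sum_x f x *: of_ x.
Proof.
apply/ffunP=> z; rewrite sum_ffunE (bigD1 z) //= !ffunE eqxx.
rewrite big1 => [|u nuz]; first by rewrite addr0 /GRing.scale /= mulr1.
by rewrite !ffunE eq_sym (negPf nuz) scaler0.
Qed.

Lemma galg_linear_ext (d e : FG -> FG) :
  linear d -> linear e -> (forall x, d (of_ x) = e (of_ x)) -> d =1 e.
Proof.
have expand (h : FG -> FG) : linear h -> forall f, h f = \sum_x f x *: h (of_ x).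
  move=> hlin f; have h0 : h 0 = 0.
    by rewrite -[X in h X](subrr 0) addrC -scaleN1r hlin scaleN1r addNr.
  rewrite {1}(galg_sum f) (big_morph h (id1 := 0) (op1 := +%R)) //.
    by apply: eq_bigr => x _; rewrite -[X in h X]addr0 hlin h0 addr0.
  by move=> u v; rewrite -{1}(scale1r u) hlin scale1r.
by move=> dlin elin de f; rewrite !expand //; apply: eq_bigr => x _; rewrite de.
Qed.

(** Scalars are central, so each coordinate of k |-> d (k 1) is a derivation of [F], hence zero. The
    Leibniz rule for k f = (k 1) f then leaves k d(f). *)
Lemma derivation_galg_scale (d : FG -> FG) : algebraic_over_prime_field F ->
  is_derivation d -> forall k f, d (k *: f) = k *: d f.
Proof.
move=> F_alg [dD dM] k f.
suff dk0 : d k%:A = 0 by rewrite -mulr_algl dM dk0 mul0r add0r mulr_algl.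
apply/ffunP=> g; rewrite [RHS]ffunE.
pose D k := (d k%:A : FG) g; rewrite -/(D k).
apply: (derivation_algebraic_over_prime_field F_alg); rewrite /D.
split=> x y /=; first by rewrite scalerDl dD ffunE.
have -> : (x * y)%:A = x%:A * y%:A :> FG by rewrite -scalerAl mul1r scalerA.
by rewrite dM -scalerAr mulr1 -scalerAl mul1r !ffunE [_ * y]mulrC.
Qed.

(** The map g |-> d(g) g^-1 is a 1-cocycle for conjugation; averaging it over a group of invertible
    order exhibits it as a coboundary. *)
Lemma derivation_galg_inner (d : FG -> FG) :
  algebraic_over_prime_field F -> #|gT|%:R != 0 :> F ->
  is_derivation d -> is_inner d.
Proof.
move=> F_alg nzG d_der; have [dD dM] := d_der.
have dZ := derivation_galg_scale F_alg d_der.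
pose c := - (#|gT|%:R : F)^-1.
pose beta : FG := c *: \sum_h d (of_ h) * of_ h^-1%g.
have dlin : linear d by move=> k u v; rewrite dD dZ.
have Llin (b : FG) : linear (fun alpha : FG => alpha * b - b * alpha).
  move=> k u v; rewrite mulrDl mulrDr scalerBr -scalerAl -scalerAr.
  by rewrite opprD addrACA.
have betaE g : of_ g * beta = beta * of_ g + d (of_ g).
  rewrite /beta -scalerAr -scalerAl mulr_sumr mulr_suml.
  (* By the Leibniz rule, g d(h) h^-1 = d(g h) h^-1 - d(g), and h^-1 = (g h)^-1 g. Reindexing by g h
     restores the sum in [beta]; d(g) is subtracted |G| times, which the factor [c] turns into +
     d(g). *)
  have -> : \sum_h of_ g * (d (of_ h) * of_ h^-1%g) =
      \sum_h (d (of_ (g * h)%g) * of_ (g * h)^-1%g * of_ g - d (of_ g)).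
    apply: eq_bigr => h _; rewrite galg_ofM dM -!mulrA -galg_ofM.
    rewrite invMg mulgKV mulrDl -!mulrA -galg_ofM mulgV galg_of1 mulr1.
    by rewrite [RHS]addrC addKr.
  rewrite [in RHS](reindex_inj (mulgI g)) sumrB /=.
  rewrite sumr_const scalerBr -scaler_nat scalerA -scaleNr.
  by rewrite /c mulNr opprK mulVf // scale1r.
exists beta; apply: (galg_linear_ext dlin (Llin beta)) => g.
by rewrite betaE addrC addKr.
Qed.

Section Scaling.

Variables (psi : gT -> F) (w : FG).

(** The linear extension of g |-> psi(g) g w; the outer derivation below has this form. *)
Definition galg_twist (f : FG) : FG := \sum_x (psi x * f x) *: (of_ x * w).

Lemma galg_twist_linear : linear galg_twist.
Proof.
move=> k u v; rewrite /galg_twist scaler_sumr -big_split /=.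
apply: eq_bigr => x _; rewrite !ffunE scalerA -scalerDl mulrDr; congr (_ *: _).
by rewrite /GRing.scale /= mulrCA.
Qed.

Lemma galg_twist_of x : galg_twist (of_ x) = psi x *: (of_ x * w).
Proof.
rewrite /galg_twist (bigD1 x) //= ffunE eqxx mulr1 big1 ?addr0 // => y nyx.
by rewrite ffunE (negPf nyx) mulr0 scale0r.
Qed.

(** The hypothesis is the Leibniz rule on pairs of group elements. Both sides are linear in each
    factor, so it extends first in the left one, then in the right one. *)
Lemma galg_twist_derivation :
  (forall g h, psi (g * h)%g *: (of_ (g * h)%g * w) =
     psi g *: (of_ g * w * of_ h) + psi h *: (of_ (g * h)%g * w)) ->
  is_derivation galg_twist.
Proof.
move=> psiM; have lin := galg_twist_linear; split=> [x y|].
  by rewrite -{1}(scale1r x) lin scale1r.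
have basis g h : galg_twist (of_ g * of_ h) =
    galg_twist (of_ g) * of_ h + of_ g * galg_twist (of_ h).
  rewrite -galg_ofM !galg_twist_of psiM -scalerAl -scalerAr galg_ofM.
  by rewrite -(mulrA (of_ g) (of_ h)).
have basisr f h : galg_twist (f * of_ h) =
    galg_twist f * of_ h + f * galg_twist (of_ h).
  pose L (u : FG) := galg_twist (u * of_ h).
  pose M (u : FG) := galg_twist u * of_ h + u * galg_twist (of_ h).
  apply: (@galg_linear_ext L M) => [k u v|k u v|g]; last exact: basis.
    by rewrite /L mulrDl -scalerAl lin.
  by rewrite /M lin !mulrDl -!scalerAl scalerDr addrACA.
move=> f g; pose L (u : FG) := galg_twist (f * u).
pose M (u : FG) := galg_twist f * u + f * galg_twist u.
apply: (@galg_linear_ext L M) => [k u v|k u v|h]; last exact: basisr.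
  by rewrite /L mulrDr -scalerAr lin.
by rewrite /M lin !mulrDr -!scalerAr scalerDr addrACA.
Qed.

End Scaling.

(** Summing coefficients over a union of conjugacy classes is a trace: both sides run over pairs
    whose product lies in [C], a condition symmetric in the pair. Values of inner derivations
    therefore have sum 0 over [C]. *)
Lemma galg_class_sum_commutator (C : {pred gT}) (u v : FG) :
  (forall x y, (x * y \in C)%g = (y * x \in C)%g) ->
  \sum_(x in C) (u * v) x = \sum_(x in C) (v * u) x.
Proof.
move=> Cconj; have E (f g : FG) : \sum_(x in C) (f * g) x =
    \sum_y \sum_(z | (y * z \in C)%g) f y * g z.
  under eq_bigr => x _ do rewrite ffunE.
  rewrite exchange_big /=; apply: eq_bigr => y _.
  rewrite (reindex_inj (mulgI y)) /=; apply: eq_bigr => z _.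
  by rewrite mulKg.
rewrite !E (exchange_big_dep predT) //=; apply: eq_bigr => y _.
by apply: eq_big => [z|z _]; [exact: Cconj | exact: mulrC].
Qed.

End GroupAlgebraDerivations.

(** * The affine action on ['F_p] *)

Lemma generated_ind (gT : finGroupType) (A : {set gT}) (P : gT -> Prop) :
  <<A>>%g = [set: gT] -> P 1%g -> (forall x y, P x -> P y -> P (x * y)%g) ->
  {in A, forall x, P x} -> forall x, P x.
Proof.
move=> genA P1 PM PA x.
have Pgroup : group_set [set y | `[<P y>]].
  apply/group_setP; split; first by rewrite inE; apply/asboolP.
  by move=> y z; rewrite !inE => /asboolP Py /asboolP Pz; apply/asboolP/PM.
suff: x \in [set y | `[<P y>]] by rewrite inE => /asboolP.
apply: (@subsetP _ <<A>>%g (mem (Group Pgroup))); last by rewrite genA inE.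
by rewrite gen_subG; apply/subsetP=> y Ay; rewrite inE; apply/asboolP/PA.
Qed.

Section AffineAction.
Variable p : nat.

Definition translation : {perm 'F_p} := perm (addIr (1 : 'F_p)).
Definition negation : {perm 'F_p} := perm (@oppr_inj 'F_p).

Lemma translationX m x : (translation ^+ m)%g x = x + m%:R.
Proof.
elim: m x => [|m IHm] x; first by rewrite expg0 perm1 addr0.
by rewrite expgS permM IHm permE -addrA nat1r.
Qed.

(** The two permutations satisfy dihedral relations: the negation s is an involution inverting the
    translation r, so both mixed relations read s r = r^-1 s. The order of r divides 2n because p
    divides n. *)
Lemma V8n_relations_affine n :
  prime p -> (p %| n)%N -> V8n_relations n translation negation.
Proof.
move=> p_pr pn; have s2 : (negation * negation = 1)%g.
  by apply/permP=> x; rewrite permM !permE opprK.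
have sr2 : ((negation * translation) * (negation * translation) = 1)%g.
  by apply/permP=> x; rewrite !permM !permE opprD opprK subrK.
have sV : (negation^-1 = negation)%g by apply/eqP; rewrite eq_invg_mul s2.
have sr : (negation * translation = translation^-1 * negation^-1)%g.
  by rewrite -invMg; apply/eqP; rewrite eq_sym eq_invg_mul sr2.
split=> //; last by rewrite sV sr sV.
  apply/permP=> x; rewrite translationX perm1.
  suff /eqP-> : (2 * n)%:R == 0 :> 'F_p by rewrite addr0.
  by rewrite -(dvdn_pcharf (pchar_Fp p_pr)) dvdn_mull.
by rewrite (expgM _ 2 2) [(negation ^+ 2)%g]s2 expg1n.
Qed.

End AffineAction.

(** * An outer derivation when p divides n *)

Section OuterDerivation.
Variables (n p : nat) (gT : finGroupType) (F : fieldType).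
Hypotheses (V8n : is_V8n n gT) (p_pr : prime p) (p_odd : odd p).
Hypotheses (pF : p \in [pchar F]) (pn : (p %| n)%N).
Local Notation FG := (group_algebra F gT).
Local Notation of_ := (@galg_of F gT).

(** The embedding of ['F_p] into [F], written on representatives; characteristic p makes it
    additive. *)
Let c (x : 'F_p) : F := (x : nat)%:R.

Let cD x y : c (x + y) = c x + c y.
Proof.
rewrite /c -natrD -[RHS](GRing.natr_mod_pchar pF); congr (_%:R).
by congr (_ %% _)%N; rewrite Fp_cast.
Qed.

Let csign (e : bool) x : c ((-1) ^+ e * x) = (-1) ^+ e * c x.
Proof.
case: e; rewrite ?expr0 ?expr1 ?mul1r // !mulN1r.
by apply/eqP; rewrite -addr_eq0 -cD addNr.
Qed.

Lemma exists_outer_derivation : exists d : FG -> FG, outer_derivation d.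
Proof.
have [a [b [rel_ab genG]]] := V8n_generators V8n.
have [f [fM fa fb]] :=
  V8n_morphism V8n rel_ab genG (V8n_relations_affine p_pr pn).
have [_ _ ba b'a] := rel_ab.
(* [w] commutes with [a], and conjugation by [b] exchanges a^2 and a^-2, hence negates [w]: the same
   signs as in the affine action. *)
pose w : FG := of_ (a * a)%g - of_ (a^-1 * a^-1)%g.
have baa : (b * (a * a) = a^-1 * a^-1 * b)%g by rewrite mulgA ba -mulgA b'a mulgA.
have baV : (b * (a^-1 * a^-1) = a * a * b)%g.
  apply: (mulIg (a * a)%g); rewrite -[RHS]mulgA baa.
  have -> : (b * (a^-1 * a^-1) * (a * a) = b)%g by rewrite !mulgA !mulgKV.
  by rewrite -!mulgA !mulKVg.
have f1 : f 1%g = 1%g by apply: (mulgI (f 1%g)); rewrite -fM !mulg1.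
(* Both facts are proved in one induction so that they share the sign [e], which is eps(g). *)
have affine g : exists e : bool, (forall x, f g x = (-1) ^+ e * x + f g 0) /\
    of_ g * w = (-1) ^+ e *: (w * of_ g).
  move: g; apply: (generated_ind genG) => [|g h [e [fg wg]] [e' [fh wh]]|].
  - exists false; split=> [x|]; first by rewrite f1 !perm1 mul1r addr0.
    by rewrite scale1r galg_of1 mul1r mulr1.
  - exists (e' (+) e); split=> [x|].
      by rewrite fM !permM fg fh [f h (f g 0)]fh mulrDr addrA mulrA signr_addb.
    rewrite galg_ofM -mulrA wh -scalerAr [of_ g * (w * _)]mulrA wg.
    by rewrite -scalerAl scalerA -mulrA signr_addb.
  - move=> g; rewrite !inE => /orP[] /eqP->.
      exists false; rewrite fa; split=> [x|]; first by rewrite !permE add0r mul1r.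
      by rewrite scale1r mulrBr mulrBl -!galg_ofM mulgA mulKVg mulgKV.
    exists true; rewrite fb; split=> [x|]; first by rewrite !permE oppr0 mulN1r addr0.
    by rewrite scaleN1r mulrBr mulrBl -!galg_ofM baa baV opprB.
pose psi g := c (f g 0).
(* Permutations compose from left to right, so psi(g h) = eps(h) psi(g) + psi(h). Moving [w] past h,
   by h w = eps(h) w h, cancels eps(h). *)
have psi_cocycle g h : psi (g * h)%g *: (of_ (g * h)%g * w) =
    psi g *: (of_ g * w * of_ h) + psi h *: (of_ (g * h)%g * w).
  have [e [fh wh]] := affine h.
  rewrite /psi fM permM fh cD csign scalerDl; congr (_ + _).
  rewrite galg_ofM -mulrA wh -scalerAr scalerA mulrAC -expr2 sqrr_sign mul1r.
  by rewrite mulrA.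
exists (galg_twist psi w); split; first exact: galg_twist_derivation.
case=> beta /(_ (of_ a)) /=; rewrite galg_twist_of.
have -> : psi a = 1 by rewrite /psi fa permE add0r.
have -> : of_ a * w = of_ (a * (a * a))%g - of_ a^-1%g.
  by rewrite mulrBr -!galg_ofM mulKVg.
rewrite scale1r => da.
pose C := [pred g : gT | [exists u, g == a^-1 ^ u]%g].
have Cconj x y : (x * y \in C)%g = (y * x \in C)%g.
  wlog suff: x y / (x * y \in C)%g -> (y * x \in C)%g.
    by move=> H; apply/idP/idP; apply: H.
  rewrite !inE => /existsP[u /eqP xy]; apply/existsP; exists (u * x)%g.
  by rewrite conjgM -xy conjgE mulgA mulKg.
have sumC g : \sum_(x in C) of_ g x = (g \in C)%:R.
  have [Cg | nCg] := boolP (g \in C).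
    rewrite (bigD1 g) //= ffunE eqxx big1 ?addr0 // => x /andP[_ nxg].
    by rewrite ffunE (negPf nxg).
  rewrite big1 // => x Cx; rewrite ffunE; case: eqP => // xg.
  by rewrite -xg Cx in nCg.
have aVC : (a^-1)%g \in C by apply/existsP; exists 1%g; rewrite conjg1.
(* If a^3 = u^-1 a^-1 u, then a u a^3 = u. Following the point 0 through the action gives eps(u) + 3
   = 0 in ['F_p], that is 2 = 0 or 4 = 0, which is excluded for odd p. *)
have a3C : (a * (a * a))%g \notin C.
  apply/existsP=> -[u /eqP a3].
  have {a3} /(congr1 (fun g => f g 0)) : (a * u * (a * (a * a)) = u)%g.
    by rewrite a3 conjgE !mulgA mulgK mulgV mul1g.
  have [e [fu _]] := affine u.
  rewrite !fM fa !permM !permE add0r fu mulr1 => fau.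
  have {fau} e3 : (-1) ^+ e + 3%:R = 0 :> 'F_p.
    by apply: (addrI (f u 0)); rewrite addr0 -[RHS]fau -!addrA [RHS]addrCA.
  have two_pow_neq0 k : (2 ^ k)%:R != 0 :> 'F_p.
    rewrite -(dvdn_pcharf (pchar_Fp p_pr)) Euclid_dvdX //.
    by apply/negP=> /andP[]; rewrite dvdn_prime2 // => /eqP p2; move: p_odd;
      rewrite p2.
  case: e {fu} e3; rewrite ?expr1 ?expr0.
    by rewrite mulrSr addrC -addrA subrr addr0; apply/eqP/(two_pow_neq0 1%N).
  by rewrite nat1r; apply/eqP/(two_pow_neq0 2%N).
(* If d were inner, the coefficients of d(a) = a^3 - a^-1 over [C] would sum to 0; they sum to 0 -
   1. *)
have := galg_class_sum_commutator (of_ a) beta Cconj; rewrite -/C.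
move/eqP; rewrite -subr_eq0 -sumrB.
have -> : \sum_(x in C) ((of_ a * beta) x - (beta * of_ a) x) =
   \sum_(x in C) of_ (a * (a * a))%g x - \sum_(x in C) of_ a^-1%g x.
  by rewrite -sumrB; apply: eq_bigr => x _; have /ffunP/(_ x) := da; rewrite !ffunE.
by rewrite !sumC aVC (negPf a3C) sub0r oppr_eq0 oner_eq0.
Qed.

End OuterDerivation.

(** * Invertibility of the group order, and the two cases *)

Lemma card_V8n_neq0 n (gT : finGroupType) (F : fieldType) p :
  (0 < n)%N -> is_V8n n gT -> prime p -> odd p ->
  [pchar F] =i pred0 \/ (p \in [pchar F] /\ gcdn n p = 1%N) ->
  #|gT|%:R != 0 :> F.
Proof.
move=> n_gt0 V8n p_pr p_odd charF.
suff nz16n : (16 * n)%:R != 0 :> F.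
  have /dvdnP[k kE] := V8n_card_dvd V8n.
  by apply: contraNneq nz16n => G0; rewrite kE natrM G0 mulr0.
case: charF => [char0 | [pF np1]].
  by have /pcharf0P-> := char0; rewrite -lt0n muln_gt0.
rewrite -(dvdn_pcharf pF) Euclid_dvdM // (Euclid_dvdX 2 4) // andbT.
rewrite dvdn_prime2 // negb_or; apply/andP; split.
  by apply: contraTneq p_odd => ->.
by rewrite -prime_coprime // coprime_sym /coprime np1.
Qed.

Local Open Scope classical_set_scope.

Theorem corollary3p4 (n : nat) (n_gt0 : (0 < n)%N)
    (gT : finGroupType) (V8n : is_V8n n gT)
    (F : fieldType) (F_alg : algebraic_over_prime_field F)
    (p : nat) (p_prime : prime p) (p_odd : odd p) :
  ([pchar F] =i pred0 \/ (p \in [pchar F] /\ gcdn n p = 1%N) ->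
     Der (group_algebra F gT) = Der_inn (group_algebra F gT) /\
     ~ (exists d : group_algebra F gT -> group_algebra F gT,
          outer_derivation d /\ d <> (fun=> 0))) /\
  (p \in [pchar F] /\ gcdn n p <> 1%N ->
     Der_inn (group_algebra F gT) `<` Der (group_algebra F gT) /\
     (exists d : group_algebra F gT -> group_algebra F gT,
          outer_derivation d /\ d <> (fun=> 0))).
Proof.
split=> [charF | [pF np1]].
  have all_inner (d : group_algebra F gT -> group_algebra F gT) :
      is_derivation d -> is_inner d.
    exact: (derivation_galg_inner F_alg
              (card_V8n_neq0 n_gt0 V8n p_prime p_odd charF)).
  split.
    apply/seteqP; split=> [d d_der | d []] //.
    by split=> //; apply: all_inner.
  by case=> d [[d_der /(_ (all_inner d d_der))]].
have pn : (p %| n)%N.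
  apply/negPn; rewrite -prime_coprime //; apply/negP=> /eqP.
  by rewrite gcdnC.
have [d [d_der d_outer]] := exists_outer_derivation V8n p_prime p_odd pF pn.
split.
  by split=> [e [] | sub] //; have [_ /d_outer] := sub d d_der.
(* The zero map is inner, with beta = 0, so an outer derivation is nonzero. *)
exists d; split=> // d0; apply: d_outer; exists 0 => alpha.
by rewrite d0 mulr0 mul0r subrr.
Qed.
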